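(* Let $K$ and $L$ be minimal finite simplicial complexes and let $\varphi:K\to L$ be a strong equivalence. Then $\varphi$ is an isomorphism of simplicial complexes.
   Context: All simplicial complexes are finite (simplices are nonempty finite sets of vertices). For a vertex $v$ of a complex $K$, the link $\mathrm{lk}_K(v)$ is the subcomplex of simplices $\tau\in K$ with $v\notin\tau$ and $\tau\cup\{v\}\in K$. A simplicial cone is a complex $aM$, the join of a (possibly empty) complex $M$ and a vertex $a$ not in $M$; its simplices are $\{a\}$, the simplices $\tau$ of $M$, and the sets $\{a\}\cup\tau$ with $\tau\in M$. A vertex $v$ of $K$ is dominated if $\mathrm{lk}_K(v)$ is a simplicial cone. A complex is minimal if it has no dominated vertices. Two simplicial maps $\varphi,\psi:K\to L$ are contiguous if $\varphi(\sigma)\cup\psi(\sigma)$ is a simplex of $L$ for every simplex $\sigma\in K$. The equivalence classes of the equivalence relation generated by contiguity are called contiguity classes, and $\varphi\sim\psi$ means that $\varphi$ and $\psi$ lie in the same contiguity class. A simplicial map $\varphi:K\to L$ is a strong equivalence if there is a simplicial map $\psi:L\to K$ such that $\psi\varphi\sim 1_K$ and $\varphi\psi\sim 1_L$. *)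

(* Defs.v *)
From mathcomp Require Import all_boot.
From Stdlib Require Import Relations.

Set Implicit Arguments.
Unset Strict Implicit.
Unset Printing Implicit Defensive.

(* The vertices of [K] are the [v] with [[set v] \in K]; they need not exhaust
   the ambient type [V], so that subcomplexes of [K] are again complexes on [V].
   The empty complex is allowed. *)
Record complex (V : finType) := Complex {
  simplices :> {set {set V}};
  simplex_nonempty : set0 \notin simplices;
  simplex_sub : forall s t : {set V},
    s \in simplices -> t \subset s -> t != set0 -> t \in simplices
}.

Definition vertices (V : finType) (K : complex V) : {set V} :=
  [set v | [set v] \in simplices K].

Section LinkCone.
Variables (V : finType) (K : complex V).

Definition link_simplices (v : V) : {set {set V}} :=
  [set t in simplices K | (v \notin t) && (v |: t \in simplices K)].

Lemma link_nonempty v : set0 \notin link_simplices v.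
Proof. by rewrite inE (negPf (simplex_nonempty K)). Qed.

Lemma link_sub v (s t : {set V}) :
  s \in link_simplices v -> t \subset s -> t != set0 -> t \in link_simplices v.
Proof.
rewrite !inE => /and3P[sK vs vsK] ts t0; apply/and3P; split.
- exact: simplex_sub sK ts t0.
- by apply: contra vs => /(subsetP ts).
- apply: simplex_sub vsK (setUS _ ts) _.
  by apply/set0Pn; exists v; rewrite setU11.
Qed.

Definition link (v : V) : complex V := Complex (link_nonempty v) (@link_sub v).

Definition cone_simplices (a : V) : {set {set V}} :=
  [set a] |: (simplices K :|: [set a |: t | t in simplices K]).

Lemma cone_nonempty a : set0 \notin cone_simplices a.
Proof.
have ne (t : {set V}) : (set0 == a |: t) = false.
  by apply/negP => /eqP/setP/(_ a); rewrite setU11 inE.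
rewrite !in_setU (negPf (simplex_nonempty K)) in_set1; apply/orP => -[].
  by move=> /eqP/setP/(_ a); rewrite set11 inE.
by case/imsetP => t _ /eqP; rewrite ne.
Qed.

Lemma cone_sub a (s t : {set V}) :
  s \in cone_simplices a -> t \subset s -> t != set0 -> t \in cone_simplices a.
Proof.
rewrite !inE => sC ts t0.
case: (boolP (t == [set a])) => //= ta.
have [at_|at_] := boolP (a \in t); last first.
  case/or3P: sC => [/eqP sa|sK|/imsetP[u uK su]].
  - move: ts; rewrite sa subset1 (negPf ta) (negPf t0) //.
  - by rewrite (simplex_sub sK ts t0).
  - rewrite (simplex_sub uK _ t0) //; apply/subsetP => x xt.
    move/subsetP/(_ x xt): ts; rewrite su in_setU1 => /orP[/eqP xa|//].
    by rewrite -xa xt in at_.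
have t'0 : t :\ a != set0.
  apply: contra ta => /eqP e; by rewrite -(setD1K at_) e setU0.
case/or3P: sC => [/eqP sa|sK|/imsetP[u uK su]].
- by move: ts; rewrite sa subset1 (negPf ta) (negPf t0).
- by rewrite (simplex_sub sK ts t0).
- apply/orP; right; apply/imsetP; exists (t :\ a); last by rewrite setD1K.
  apply: (simplex_sub uK _ t'0); apply/subsetP => x; rewrite in_setD1.
  case/andP=> xa xt; move/subsetP/(_ x xt): ts.
  by rewrite su in_setU1 (negPf xa).
Qed.

Definition cone (a : V) : complex V := Complex (cone_nonempty a) (@cone_sub a).

End LinkCone.

Definition simplicial_cone (V : finType) (C : complex V) : Prop :=
  exists (a : V) (M : complex V),
    a \notin vertices M /\ simplices C = simplices (cone M a).

Definition dominated (V : finType) (K : complex V) (v : V) : Prop :=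
  v \in vertices K /\ simplicial_cone (link K v).

Definition minimal_complex (V : finType) (K : complex V) : Prop :=
  forall v : V, ~ dominated K v.

Definition vertex (V : finType) (K : complex V) : finType :=
  {v : V | v \in vertices K}.

Definition image_simplex (V W : finType) (K : complex V) (L : complex W)
    (f : vertex K -> vertex L) (s : {set V}) : {set W} :=
  [set val (f x) | x : vertex K & val x \in s].

Record simplicial_map (V W : finType) (K : complex V) (L : complex W) :=
  SimplicialMap {
    vertex_map :> vertex K -> vertex L;
    image_simplexP : forall s : {set V},
      s \in simplices K -> image_simplex vertex_map s \in simplices L
  }.

Lemma simplex_vertex (V : finType) (K : complex V) (s : {set V}) (v : V) :
  s \in simplices K -> v \in s -> v \in vertices K.
Proof.
move=> sK vs; rewrite inE; apply: simplex_sub sK _ _; rewrite ?sub1set //.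
by apply/set0Pn; exists v; rewrite set11.
Qed.

Lemma image_simplex_id (V : finType) (K : complex V) (s : {set V}) :
  s \in simplices K -> image_simplex (id : vertex K -> vertex K) s = s.
Proof.
move=> sK; apply/setP => v; apply/imsetP/idP => [[x]|vs].
  by rewrite inE => xs ->.
by exists (Sub v (simplex_vertex sK vs)); rewrite ?inE SubK.
Qed.

Lemma image_simplex_comp (U V W : finType) (K : complex U) (L : complex V)
    (M : complex W) (g : vertex L -> vertex M) (f : vertex K -> vertex L)
    (s : {set U}) :
  image_simplex (g \o f) s = image_simplex g (image_simplex f s).
Proof.
apply/setP => w; apply/imsetP/imsetP => -[x].
  rewrite inE => xs ->; exists (f x) => //.
  by rewrite inE; apply/imsetP; exists x; rewrite ?inE.
rewrite inE => /imsetP[y]; rewrite inE => ys /val_inj -> ->.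
by exists y; rewrite ?inE.
Qed.

Definition id_map (V : finType) (K : complex V) : simplicial_map K K :=
  @SimplicialMap V V K K id
    (fun s sK => eq_ind_r (fun t => t \in simplices K) sK
                          (image_simplex_id sK)).

Definition comp_map (U V W : finType) (K : complex U) (L : complex V)
    (M : complex W) (g : simplicial_map L M) (f : simplicial_map K L) :
    simplicial_map K M :=
  @SimplicialMap U W K M (g \o f)
    (fun s sK => eq_ind_r (fun t => t \in simplices M)
                          (image_simplexP g (image_simplexP f sK))
                          (image_simplex_comp g f s)).

Definition contiguous (V W : finType) (K : complex V) (L : complex W)
    (f g : simplicial_map K L) : Prop :=
  forall s : {set V}, s \in simplices K ->
    image_simplex f s :|: image_simplex g s \in simplices L.

Definition same_contiguity_class (V W : finType) (K : complex V)
    (L : complex W) : relation (simplicial_map K L) :=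
  clos_refl_sym_trans (simplicial_map K L) (@contiguous V W K L).

Definition strong_equivalence (V W : finType) (K : complex V) (L : complex W)
    (f : simplicial_map K L) : Prop :=
  exists g : simplicial_map L K,
    same_contiguity_class (comp_map g f) (id_map K) /\
    same_contiguity_class (comp_map f g) (id_map L).

Definition simplicial_isomorphism (V W : finType) (K : complex V)
    (L : complex W) (f : simplicial_map K L) : Prop :=
  exists g : simplicial_map L K, cancel f g /\ cancel g f.

(* Main.v *)
Require Import Defs.
From mathcomp Require Import all_boot.

(** If [f] is contiguous to the identity and [f v <> v], then every simplex
    containing [v] can be enlarged by [f v], so the link of [v] is a cone with
    apex [f v] and [v] is dominated. Hence in a minimal complex the contiguity
    class of the identity is trivial, and a homotopy inverse of a strong
    equivalence is a genuine inverse. *)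

(** The base of the cone consists of the simplices of [C] that avoid [a]; a simplex [t] containing
    [a] is then [[set a]] or the join of [a] with [t :\ a]. *)
Lemma simplicial_cone_apex (V : finType) (C : complex V) (a : V) :
  [set a] \in simplices C ->
  (forall t, t \in simplices C -> a |: t \in simplices C) ->
  simplicial_cone C.
Proof.
move=> aC joinC; pose D := [set t in simplices C | a \notin t].
have D0 : set0 \notin D by rewrite inE (negPf (simplex_nonempty C)).
have Dsub (s t : {set V}) : s \in D -> t \subset s -> t != set0 -> t \in D.
  rewrite !inE => /andP[sC as_] ts t0; rewrite (simplex_sub sC ts t0) /=.
  by apply: contra as_ => /(subsetP ts).
exists a, (Complex D0 Dsub); split; first by rewrite !inE eqxx andbF.
apply/setP => t; rewrite !in_setU in_set1 /= inE.
apply/idP/or3P => [tC|].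
  have [at_|at_] := boolP (a \in t); last by apply: Or32; rewrite tC.
  (* The case [t = [set a]] is separate because the empty set is not a simplex of the base. *)
  have [t0|t0] := eqVneq (t :\ a) set0.
    by apply: Or31; rewrite -(setD1K at_) t0 setU0.
  apply: Or33; apply/imsetP; exists (t :\ a); last by rewrite setD1K.
  by rewrite inE setD11 (simplex_sub tC (subsetDl _ _) t0).
case=> [/eqP->//|/andP[]//|/imsetP[u]].
by rewrite inE => /andP[uC _] ->; apply: joinC.
Qed.

Lemma eq_image_simplex (V W : finType) (K : complex V) (L : complex W)
    (f g : vertex K -> vertex L) (s : {set V}) :
  f =1 g -> image_simplex f s = image_simplex g s.
Proof. by move=> fg; apply: eq_imset => x; rewrite fg. Qed.

Lemma minimal_contiguous_id (V : finType) (K : complex V)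
    (f g : simplicial_map K K) :
  minimal_complex K -> contiguous f g -> f =1 id -> g =1 id.
Proof.
move=> minK fg fid v; apply/val_inj/eqP/negPn/negP => gv.
(* Since [f] fixes [s], contiguity makes [s :|: image_simplex g s] a simplex, and it contains
   [val (g v)]. *)
have enlarge (s : {set V}) : s \in simplices K -> val v \in s ->
    val (g v) |: s \in simplices K.
  move=> sK vs; apply: simplex_sub (fg s sK) _ _.
    rewrite (@eq_image_simplex _ _ _ _ _ _ _ fid) image_simplex_id // setUC.
    rewrite setUS // sub1set; apply/imsetP; exists v => //.
    by rewrite inE.
  by apply/set0Pn; exists (val (g v)); rewrite setU11.
have vK : [set val v] \in simplices K by have := valP v; rewrite inE.
have gvK : [set val (g v)] \in simplices K by have := valP (g v); rewrite inE.
apply: (minK (val v)); split; first exact: valP.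
apply: (@simplicial_cone_apex _ _ (val (g v))) => [|t].
  rewrite inE gvK in_set1 eq_sym gv setUC.
  by apply: enlarge; rewrite ?set11.
rewrite !inE => /and3P[tK vt vtK].
(* Here [enlarge] is applied to [val v |: t], which contains [val v] even though [t] does not. *)
have gvtK : val v |: (val (g v) |: t) \in simplices K.
  by rewrite setUCA; apply: enlarge; rewrite ?setU11.
rewrite negb_or eq_sym gv vt gvtK !andbT.
apply: simplex_sub gvtK (subsetUr _ _) _.
by apply/set0Pn; exists (val (g v)); rewrite setU11.
Qed.

Lemma minimal_contiguity_class_id (V : finType) (K : complex V)
    (f : simplicial_map K K) :
  minimal_complex K -> same_contiguity_class f (id_map K) -> f =1 id.
Proof.
move=> minK fid.
(* An equivalence, unlike a one-way implication, survives the symmetric closure in the induction. *)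
suff [_] : f =1 id <-> id_map K =1 id by apply.
elim: fid => [g h gh|g|g h _ IH|g h k _ IH1 _ IH2].
- have hg : contiguous h g by move=> s sK; rewrite setUC; apply: gh.
  by split; apply: minimal_contiguous_id.
- by [].
- by split => [/IH|/IH].
- by split => [/IH1/IH2|/IH2/IH1].
Qed.

Theorem corollary2p8 (V W : finType) (K : complex V) (L : complex W)
    (hK : minimal_complex K) (hL : minimal_complex L)
    (phi : simplicial_map K L) (hphi : strong_equivalence phi) :
  simplicial_isomorphism phi.
Proof.
have [psi [psiphi phipsi]] := hphi; exists psi.
split; [exact: minimal_contiguity_class_id hK psiphi
       |exact: minimal_contiguity_class_id hL phipsi].
Qed.
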